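(* Let $d\ge1$ and $\gamma\in\mathbb{R}\setminus\{0\}$, and let $Z$ be the dyadic branching Brownian motion in $\mathbb{R}^d$ with unit time branching and self-interaction parameter $\gamma$. Let $\overline{Z}_t:=\frac1{n_t}\sum_{i=1}^{n_t}Z_t^i$ be its center of mass. Then, almost surely, $\lim_{t\to\infty}\overline{Z}_t=N$, where $N$ is a random vector with $N\sim\mathcal{N}^d(0,2)$.
   Context: Model. Put $n_t:=2^{\lfloor t\rfloor}$. The process $Z_t=(Z_t^1,\dots,Z_t^{n_t})$, $Z_t^i\in\mathbb{R}^d$, is defined inductively. $Z_0$ is a single particle at the origin. At each integer time $m\ge1$ every particle is replaced by two offspring located at the parent's position (the offspring of particle $i$ are labeled $2i-1$ and $2i$). On $[m,m+1)$, $m=0,1,2,\dots$, the $2^m$ particles move according to $$Z_{m+\tau}^i=Z_m^i+B_0^i(\tau)+\frac{\gamma}{2^m}\int_0^\tau\sum_{j=1}^{2^m}\bigl(Z_{m+s}^j-Z_{m+s}^i\bigr)\,ds,\qquad \tau\in[0,1),\ 1\le i\le 2^m,$$ where $B_0^1,\dots,B_0^{2^m}$ (depending on $m$) are independent standard $d$-dimensional Brownian motions started at $0$, independent of the past up to time $m$, and $Z_m^i$ is the position of the parent at time $m-0$. $\mathcal{N}^d(0,2)$ denotes the $d$-dimensional centered normal distribution with covariance matrix $2\mathbf{I}_d$ (the law of a standard $d$-dimensional Brownian motion at time $2$). *)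

(* Defs.v *)
From mathcomp Require Import all_boot all_order all_algebra.
From mathcomp Require Import all_classical all_reals all_analysis.

Set Implicit Arguments.
Unset Strict Implicit.
Unset Printing Implicit Defensive.

Import Order.TTheory GRing.Theory Num.Theory.
Import numFieldNormedType.Exports.

Local Open Scope classical_set_scope.
Local Open Scope ring_scope.

(* R^n is 'rV[R]_n with its normed-space topology.  The library puts no
   sigma-algebra on matrices: the one meant here is generated by the
   coordinates, i.e. the Borel one. *)
Section random_vectors.
Context (disp : measure_display) (T : measurableType disp) (R : realType).
Context (P : probability T R) (n : nat).

Definition random_vector (X : T -> 'rV[R]_n) : Prop :=
  forall k : 'I_n, measurable_fun setT (fun w => X w 0 k).

(* The sigma-field sigma(X_a : a in D). *)
Definition sigma_field (I : Type) (D : set I) (X : I -> T -> 'rV[R]_n) :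
    set (set T) :=
  <<s \bigcup_(a in D) \bigcup_(k in [set: 'I_n])
        preimage_set_system setT (fun w => X a w 0 k) measurable >>.

Definition independent (F G : set (set T)) : Prop :=
  forall A B, F A -> G B -> P (A `&` B) = (P A * P B)%E.

Definition mutually_independent (I : finType) (F : I -> set (set T)) : Prop :=
  forall (J : {set I}) (A : I -> set T), (forall i, i \in J -> F i (A i)) ->
  P (\bigcap_(i in [set` J]) A i) = (\prod_(i in J) P (A i))%E.

(* N(m, v) on the line, v being the variance.  [normal_prob] takes the standard
   deviation, and for standard deviation 0 it is the uniform law on [0, 1]
   instead of a point mass. *)
Definition normal_law (m v : R) (A : set R) : \bar R :=
  if v == 0 then \d_m A else normal_prob m (Num.sqrt v) A.

(* X ~ N(mu, Sigma): every linear functional u . X is normal, with mean u . mu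
   and variance u Sigma u^T. *)
Definition normal_vector (mu : 'rV[R]_n) (Sigma : 'M[R]_n)
    (X : T -> 'rV[R]_n) : Prop :=
  random_vector X /\
  forall (u : 'rV[R]_n) (A : set R), measurable A ->
    P [set w | A ((u *m (X w)^T) 0 0)] =
    normal_law ((u *m mu^T) 0 0) ((u *m Sigma *m u^T) 0 0) A.

(* Only times t >= 0 matter. *)
Record standard_brownian (B : R -> T -> 'rV[R]_n) : Prop := StandardBrownian {
  brownian_random_vector : forall t, 0 <= t -> random_vector (B t);
  brownian_start : {ae P, forall w, B 0 w = 0};
  brownian_continuous :
    {ae P, forall w, {within `[0, +oo[, continuous (fun t => B t w)}};
  brownian_increment_law : forall s t, 0 <= s -> s < t ->
    normal_vector 0 (t - s)%:M (fun w => B t w - B s w);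
  brownian_increment_indep : forall s t, 0 <= s -> s < t ->
    independent
      (sigma_field [set: unit] (fun _ w => B t w - B s w))
      (sigma_field [set u | 0 <= u <= s] B) }.

End random_vectors.

Section dyadic_bbm.
Context (disp : measure_display) (T : measurableType disp) (R : realType).
Context (P : probability T R) (n : nat).

(* [Num.truncn] is the integer part of a nonnegative number. *)
Definition nb_particles (t : R) : nat := 2 ^ Num.truncn t.

(* Particles are numbered from 0, so the offspring of i are 2i and 2i+1 and the
   parent of i is i./2.  A configuration process is Z : R -> nat -> T -> 'rV_n,
   of which only the values Z t i with 0 <= t and i < nb_particles t matter. *)
Definition center_of_mass (Z : R -> nat -> T -> 'rV[R]_n) (t : R) (w : T) :
    'rV[R]_n :=
  (nb_particles t)%:R^-1 *: \sum_(i < nb_particles t) Z t i w.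

(* sum_j (Z_{m+s}^j - Z_{m+s}^i), for s in [0, 1) *)
Definition attraction (Z : R -> nat -> T -> 'rV[R]_n) (m i : nat) (w : T)
    (s : R) : 'rV[R]_n :=
  \sum_(j < 2 ^ m) (Z (m%:R + s) j w - Z (m%:R + s) i w).

(* B m i is the Brownian motion driving particle i during [m, m+1).  The
   integral in the equation of motion is taken coordinatewise; as the library
   integral is total, the integrability that the equation presupposes is
   explicit. *)
Record dyadic_bbm (gamma : R) (B : nat -> nat -> R -> T -> 'rV[R]_n)
    (Z : R -> nat -> T -> 'rV[R]_n) : Prop := DyadicBBM {
  bbm_random_vector : forall t i, 0 <= t -> (i < nb_particles t)%N ->
    random_vector (Z t i);
  bbm_noise : forall m i, (i < 2 ^ m)%N -> standard_brownian P (B m i);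
  bbm_noise_indep : forall m,
    mutually_independent P
      (fun i : 'I_(2 ^ m) => sigma_field [set t | 0 <= t] (B m i));
  bbm_noise_past : forall m,
    independent P
      (sigma_field [set a : nat * R | (a.1 < 2 ^ m)%N /\ 0 <= a.2]
         (fun a => B m a.1 a.2))
      (sigma_field
         [set a : R * nat | 0 <= a.1 <= m%:R /\ (a.2 < nb_particles a.1)%N]
         (fun a => Z a.1 a.2));
  bbm_start : {ae P, forall w, Z 0 0%N w = 0};
  bbm_branching : {ae P, forall w, forall m i, (i < 2 ^ m.+1)%N ->
    Z t i./2 w @[t --> (m.+1%:R : R)^'-] --> Z m.+1%:R i w};
  bbm_motion : {ae P, forall w, forall m i (tau : R),
    (i < 2 ^ m)%N -> 0 <= tau < 1 ->
    (forall k, lebesgue_measure.-integrable `[0, tau]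
       (EFin \o (fun s => attraction Z m i w s 0 k))) /\
    Z (m%:R + tau) i w =
      Z m%:R i w + B m i tau w +
      (gamma / 2 ^+ m) *:
        \row_k \int[lebesgue_measure]_(s in `[0, tau])
                 attraction Z m i w s 0 k} }.

End dyadic_bbm.

(* Main.v *)
Require Import Defs.
From mathcomp Require Import all_boot all_order all_algebra.
From mathcomp Require Import all_classical all_reals all_analysis.
From mathcomp Require Import measurable_realfun zify ring lra.

(** The attraction is antisymmetric, so it cancels in the average: between
    branching times the center of mass moves by W_m(t), the average of the
    2^m driving Brownian motions ([center_of_mass_step]).  Branching does not
    move it, because each particle is replaced by two copies.  Hence the center
    of mass at time m is the sum of the W_l(1), l < m, and by
    [mean_noise_increment_law] the vector W_l(t) - W_l(s) is centred normal with
    covariance (t - s) / 2^l times the identity.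

    Law of the limit.  W_m is independent of the past, so the variances add up:
    at time m the center of mass is normal with variance
    1 + 1/2 + ... + 1/2^(m-1) = 2 - 2/2^m ([center_of_mass_law]).  Both this
    and the law of an average of Brownian motions rest on one statement about
    sums, [normal_prob_add], in which independence is expressed by a product
    formula on an event G.  Variances increase to 2, so the density of each of
    these laws is at most a constant c_m times that of the limit law, with c_m
    tending to 1, and this domination passes to the almost sure limit
    ([probability_limit_eq]).

    Almost sure convergence.  One needs the supremum of W_m over [0, 1] to be
    almost surely summable in m, and this follows by dyadic chaining: a normal
    variable of variance v exceeds l in absolute value with probability at most
    64 v^2 / l^4 ([normal_prob_tail]); by the Borel-Cantelli lemma, almost
    surely and for all large m, every coordinate of every increment of W_m over
    a dyadic interval of length 2^-n is at most r^(m + n), with r = 9/10; by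
    continuity this bounds the coordinates of W_m on [0, 1] by r^m / (1 - r)
    ([chaining], [ae_mean_noise_small]).  So the positions at integer times are
    a Cauchy sequence, and the motion in between becomes negligible
    ([ae_cvg_com]). *)

Set Implicit Arguments.
Unset Strict Implicit.
Unset Printing Implicit Defensive.

Import Order.TTheory GRing.Theory Num.Theory.
Import numFieldNormedType.Exports.

Local Open Scope classical_set_scope.
Local Open Scope ring_scope.

(** * Convolution of normal laws *)

Section normal_convolution.
Context {R : realType}.
Local Notation mu := (@lebesgue_measure R).

(** The Radon-Nikodym derivative of the normal law agrees almost everywhere with
    the density that defines it, and integrals against the law are integrals
    against that derivative. *)
Lemma normal_prob_density (m s : R) (f : measurableTypeR R -> \bar R) :
  measurable_fun setT f -> (forall x, 0 <= f x)%E ->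
  (\int[normal_prob m s]_x f x = \int[mu]_x (f x * (normal_pdf m s x)%:E))%E.
Proof.
move=> mf f0; have dom := normal_prob_dominates m s.
rewrite -(Radon_Nikodym_SigmaFinite.change_of_variables dom)//.
have mpdf : measurable_fun setT (EFin \o normal_pdf m s).
  by apply/measurable_EFinP; exact: measurable_normal_pdf.
apply: ae_eq_integral => //.
- apply: emeasurable_funM => //.
  exact: measurable_int (Radon_Nikodym_SigmaFinite.f_integrable dom).
- exact: emeasurable_funM.
apply: ae_eqe_mul2l; apply: integral_ae_eq => //.
- exact: Radon_Nikodym_SigmaFinite.f_integrable.
- move=> E _ mE; rewrite -Radon_Nikodym_SigmaFinite.f_integral//.
Qed.

Lemma lebesgue_measure_shift (a : R) (A : set R) : measurable A ->
  pushforward mu (fun x : measurableTypeR R => (a + x : measurableTypeR R)) A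
  = mu A.
Proof.
move=> mA.
have mphi : measurable_fun setT
    (fun x : measurableTypeR R => (a + x : measurableTypeR R)).
  exact: measurable_funD.
apply/esym.
pose m' := pushforward mu (fun x : measurableTypeR R => (a + x : measurableTypeR R)).
apply: (lebesgue_measure_unique (mu := m')) => //= _ [[x y]] _ <-.
rewrite /m' /pushforward.
have -> : (fun z : R => a + z) @^-1` `]x, y] = `]x - a, y - a]%classic.
  by apply/seteqP; split => z /=; rewrite !in_itv/=; lra.
rewrite !lebesgue_measure_itv/= !lte_fin ltrD2r; case: ifPn => // _.
by rewrite -!EFinD; congr EFin; lra.
Qed.

Lemma normal_prob_shift (s a : R) (A : set R) : s != 0 -> measurable A ->
  normal_prob 0 s ((fun x => a + x) @^-1` A) = normal_prob a s A.
Proof.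
move=> s0 mA; rewrite /normal_prob.
pose phi := fun x : measurableTypeR R => (a + x : measurableTypeR R).
have mphi : measurable_fun setT phi by exact: measurable_funD.
transitivity (\int[pushforward mu phi]_(x in A) (normal_pdf a s x)%:E)%E; last first.
  apply: eq_measure_integral => //= B mB BA; exact: lebesgue_measure_shift.
have mpdf : measurable_fun setT (fun x : measurableTypeR R => (normal_pdf a s x)%:E).
  by apply/measurable_EFinP; exact: measurable_normal_pdf.
rewrite (ge0_integral_pushforward mphi mu mA (measurable_funTS mpdf)); last first.
  by move=> x _; rewrite lee_fin normal_pdf_ge0.
apply: eq_integral => x _; rewrite /comp /phi !normal_pdfE// /normal_fun.
by rewrite subr0 [a + x]addrC addrK.
Qed.

(** Completing the square in x: the joint density of a centred normal variable
    and of its sum with an independent one is the density of the sum times the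
    conditional density of the first summand given the sum. *)
Lemma normal_pdf_complete_square (a b x z : R) : 0 < a -> 0 < b ->
  normal_pdf 0 (Num.sqrt a) x * normal_pdf x (Num.sqrt b) z =
  normal_pdf 0 (Num.sqrt (a + b)) z *
  normal_pdf (z * a / (a + b)) (Num.sqrt (a * b / (a + b))) x.
Proof.
move=> a0 b0.
have ab0 : 0 < a + b by lra.
have c0 : 0 < a * b / (a + b) by rewrite divr_gt0// mulr_gt0.
rewrite !normal_pdfE ?gt_eqF ?sqrtr_gt0//.
rewrite mulrACA [RHS]mulrACA /normal_peak /normal_fun -!expRD !sqr_sqrtr ?ltW//.
congr (_ * expR _).
  rewrite -!invfM -!sqrtrM ?mulrn_wge0 ?mulr_ge0 ?pi_ge0 ?ltW//.
  by congr (Num.sqrt _)^-1; field; lra.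
by field; rewrite ?mulf_neq0 ?gt_eqF//; lra.
Qed.

(** The mass that the centred law gives to the translate of A by -x is the mass
    of a section, at x, of the set of pairs whose sum lies in A. *)
Lemma measurable_normal_prob_mean (s : R) (A : set R) : s != 0 -> measurable A ->
  measurable_fun setT (fun x => normal_prob x s A).
Proof.
move=> s0 mA.
have -> : (fun x => normal_prob x s A) =
  normal_prob 0 s \o xsection ((fun z : R * R => z.1 + z.2) @^-1` A).
  apply/funext => x /=; rewrite -normal_prob_shift//; congr normal_prob.
  by apply/seteqP; split => y; rewrite /xsection /= inE.
apply: measurable_fun_xsection.
rewrite -[X in measurable X]setTI; apply: measurable_funD => //.
Qed.

(** By Tonelli one may integrate first over the mean x, for a fixed value z of
    the sum; by [normal_pdf_complete_square] what remains of the integrand is a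
    normal density in x, of mass 1. *)
Lemma normal_prob_convolution (a b : R) (A : set R) : 0 < a -> 0 < b ->
  measurable A ->
  (\int[normal_prob (0:R) (Num.sqrt a)]_x normal_prob x (Num.sqrt b) A =
   normal_prob 0 (Num.sqrt (a + b)) A)%E.
Proof.
move=> a0 b0 mA.
have sb0 : Num.sqrt b != 0 by rewrite gt_eqF ?sqrtr_gt0.
rewrite normal_prob_density//; last exact: measurable_normal_prob_mean.
pose f (z : R * R) : \bar R := ((normal_pdf 0 (Num.sqrt a) z.1 *
   normal_pdf z.1 (Num.sqrt b) z.2) * \1_A z.2)%:E.
have f0 z : (0 <= f z)%E by rewrite lee_fin !mulr_ge0 ?normal_pdf_ge0.
have mf : measurable_fun setT f.
  apply/measurable_EFinP; apply: measurable_funM; last first.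
    exact: measurableT_comp.
  apply: measurable_funM.
    by apply: measurableT_comp; first exact: measurable_normal_pdf.
  rewrite (_ : (fun _ => _) =
    normal_pdf 0 (Num.sqrt b) \o (fun z : R * R => z.2 - z.1)).
    apply: measurableT_comp; first exact: measurable_normal_pdf.
    exact: measurable_funB.
  by apply/funext => z /=; rewrite !normal_pdfE// /normal_fun subr0.
have E1 x : (normal_prob x (Num.sqrt b) A * (normal_pdf 0 (Num.sqrt a) x)%:E
  = \int[mu]_z f (x, z))%E.
  have -> : normal_prob x (Num.sqrt b) A =
      (\int[mu]_z (normal_pdf x (Num.sqrt b) z * \1_A z)%:E)%E.
    rewrite /normal_prob integral_mkcond epatch_indic.
    by under eq_integral do rewrite -EFinM.
  rewrite muleC -ge0_integralZl//.
  - by apply: eq_integral => z _; rewrite /f -EFinM mulrA.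
  - apply/measurable_EFinP; apply: measurable_funM; first exact: measurable_normal_pdf.
    exact: measurable_indic.
  - by move=> z _; rewrite lee_fin mulr_ge0 ?normal_pdf_ge0.
  - by rewrite lee_fin normal_pdf_ge0.
under eq_integral do rewrite E1.
transitivity (\int[mu]_z \int[mu]_x f (x, z))%E.
  exact: (@fubini_tonelli _ _ _ _ _ mu mu f mf f0).
rewrite /normal_prob [RHS]integral_mkcond/=; apply: eq_integral => z _.
rewrite epatch_indic/=.
under eq_integral => x _.
  rewrite /f/= normal_pdf_complete_square// [X in X%:E]mulrAC EFinM.
  over.
rewrite ge0_integralZl//=.
- by rewrite integral_normal_pdf mule1 EFinM.
- by apply/measurable_EFinP; exact: measurable_normal_pdf.
- by move=> x _; rewrite lee_fin normal_pdf_ge0.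
- by rewrite lee_fin mulr_ge0 ?normal_pdf_ge0.
Qed.

End normal_convolution.

(** * Sums of independent normal variables *)

Section normal_sums.
Context (disp : measure_display) (T : measurableType disp) (R : realType).
Context (P : probability T R).

(** The event G lets the same statement serve in the induction of
    [normal_sum_disjoint], where G is an event of the summands that are still to
    be added; G = setT is the usual addition of independent variables.  On G
    the joint law of X and Y is, up to the factor P G, the product of their
    laws. *)
Lemma normal_prob_add (X Y : T -> R) (G : set T) (a b : R) :
  0 < a -> 0 < b -> measurable_fun setT X -> measurable_fun setT Y ->
  measurable G ->
  (forall A A', measurable A -> measurable A' ->
    P (X @^-1` A `&` Y @^-1` A' `&` G) =
    (normal_prob (0:R) (Num.sqrt a) A * normal_prob (0:R) (Num.sqrt b) A' * P G)%E) ->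
  forall A, measurable A ->
    P ((fun w => X w + Y w) @^-1` A `&` G) =
    (normal_prob (0:R) (Num.sqrt (a + b)) A * P G)%E.
Proof.
move=> a0 b0 mX mY mG XY A mA.
have mXY : measurable_fun setT
    (fun w => (X w, Y w) : measurableTypeR R * measurableTypeR R).
  exact: measurable_fun_pair.
pose m' := pushforward (mrestr P mG)
  (fun w => (X w, Y w) : measurableTypeR R * measurableTypeR R).
have pG0 : 0 <= fine (P G) by apply: fine_ge0; exact: measure_ge0.
pose m1 : {sigma_finite_measure set _ -> \bar R} := normal_prob (0:R) (Num.sqrt a).
pose m2 : {sigma_finite_measure set _ -> \bar R} :=
  mscale (NngNum pG0) (normal_prob (0:R) (Num.sqrt b)).
pose E := (fun z : measurableTypeR R * measurableTypeR R =>
  z.1 + z.2 : measurableTypeR R) @^-1` A.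
have mE : measurable E.
  by rewrite -[X in measurable X]setTI; apply: measurable_funD.
have PGE : (fine (P G))%:E = P G by rewrite fineK// fin_num_measure.
transitivity (m' E); first by [].
have <- : (m1 \x m2)%E E = m' E.
  apply: product_measure_unique => // B C mB mC.
  transitivity (P (X @^-1` B `&` Y @^-1` C `&` G)); first by [].
  by rewrite XY//= /mscale/= PGE -muleA [(P G * _)%E]muleC.
have sb0 : Num.sqrt b != 0 by rewrite gt_eqF ?sqrtr_gt0.
have secE x :
    normal_prob (0:R) (Num.sqrt b) (xsection E x) = normal_prob x (Num.sqrt b) A.
  rewrite -(normal_prob_shift x sb0 mA); congr (normal_prob _ _ _).
  by apply/seteqP; split => y; rewrite /xsection /E/= inE.
transitivity (\int[m1]_x ((fine (P G))%:E * normal_prob x (Num.sqrt b) A))%E.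
  by apply: eq_integral => x _; rewrite -secE.
have mN : measurable_fun setT (fun x => normal_prob x (Num.sqrt b) A).
  by apply: measurable_normal_prob_mean => //; rewrite gt_eqF ?sqrtr_gt0.
rewrite (ge0_integralZl m1 measurableT mN) ?lee_fin; [|by []|by []].
by rewrite PGE (normal_prob_convolution a0 b0 mA) muleC.
Qed.

Section mutual_independence.
Variables (I : finType) (F : I -> set (set T)).
Hypotheses (Fm : forall i, F i `<=` measurable) (indep : mutually_independent P F).

Let bigcap_insert (i : I) (J : {set I}) (D : set T) (E : I -> set T) :
  i \notin J ->
  \bigcap_(j in [set` (i |: J)%SET]) (if j == i then D else E j) =
  D `&` \bigcap_(j in [set` J]) E j.
Proof.
move=> iJ; apply/seteqP; split => [w Ew|w [Dw Ew] j /=].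
  split; first by have := Ew i; rewrite /= eqxx; apply; exact: setU11.
  move=> j /= jJ; have := Ew j; rewrite /= ifN; last first.
    by apply: contraNneq iJ => <-.
  by apply; exact: setU1r.
by case: eqVneq => [//|ji]; rewrite in_setU1 (negbTE ji)/= => jJ; exact: Ew.
Qed.

Let family_insert (i : I) (J : {set I}) (D : set T) (E : I -> set T) :
  F i D -> (forall j, j \in J -> F j (E j)) ->
  forall j, j \in (i |: J)%SET -> F j (if j == i then D else E j).
Proof.
by move=> FD FE j; case: eqVneq => [->//|ji]; rewrite in_setU1 (negbTE ji); exact: FE.
Qed.

Let indep_insert (i : I) (J : {set I}) (D : set T) (E : I -> set T) :
  i \notin J -> F i D -> (forall j, j \in J -> F j (E j)) ->
  P (D `&` \bigcap_(j in [set` J]) E j) =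
  (P D * P (\bigcap_(j in [set` J]) E j))%E.
Proof.
move=> iJ FD FE; rewrite -(bigcap_insert _ _ iJ) indep; last exact: family_insert.
rewrite big_setU1//= eqxx indep//; congr (_ * _)%E.
by apply: eq_bigr => j jJ; rewrite ifN//; apply: contraNneq iJ => <-.
Qed.

Variables (X : I -> T -> R) (v : I -> R).
Hypotheses (mX : forall i, measurable_fun setT (X i))
  (FX : forall i A, measurable A -> F i (X i @^-1` A)) (v0 : forall i, 0 < v i)
  (lawX : forall i A, measurable A ->
    P (X i @^-1` A) = normal_prob (0:R) (Num.sqrt (v i)) A).

(** Mutual independence speaks only of intersections of events.  The induction
    therefore carries along an event of each family J outside of the sum: when
    the summand X i is added, its event joins those of J in the induction
    hypothesis for the other summands. *)
Let normal_sum_disjoint (i : I) (s : seq I) (J : {set I}) (E : I -> set T)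
    (A : set R) :
  uniq (i :: s) -> (forall j, j \in J -> j \notin i :: s) ->
  (forall j, j \in J -> F j (E j)) -> measurable A ->
  P ((fun w => \sum_(k <- i :: s) X k w) @^-1` A `&` \bigcap_(j in [set` J]) E j) =
  (normal_prob (0:R) (Num.sqrt (\sum_(k <- i :: s) v k)) A *
   P (\bigcap_(j in [set` J]) E j))%E.
Proof.
elim: s i J E A => [|i' s IH] i J E A us Js FE mA.
  have iJ : i \notin J by apply: contraTN (mem_head i [::]) => /Js.
  rewrite big_seq1 (_ : (fun w => _) = X i); last first.
    by apply/funext => w; rewrite big_seq1.
  by rewrite (indep_insert iJ) ?lawX//; exact: FX.
have iJ : i \notin J by apply: contraTN (mem_head i (i' :: s)) => /Js.
rewrite big_cons (_ : (fun w => _) =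
    (fun w => X i w + \sum_(k <- i' :: s) X k w)); last first.
  by apply/funext => w; rewrite big_cons.
have mG : measurable (\bigcap_(j in [set` J]) E j).
  by apply: fin_bigcap_measurable => // j /= jJ; exact/(Fm (i := j))/FE.
move: us; rewrite cons_uniq => /andP[ii' us].
have vs0 : 0 < \sum_(k <- i' :: s) v k.
  by rewrite big_cons ltr_pwDl// sumr_ge0// => k _; exact/ltW.
apply: normal_prob_add => //; first exact: measurable_sum.
move=> B B' mB mB'; rewrite -(lawX _ mB) -setIA setICA -(bigcap_insert _ _ iJ).
rewrite IH//.
- rewrite bigcap_insert// (indep_insert iJ)//; last exact: FX.
  by rewrite muleCA muleA.
- move=> j; rewrite in_setU1 => /predU1P[->//|/Js].
  by rewrite inE negb_or => /andP[].
- by apply: family_insert => //; exact: FX.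
Qed.

Lemma normal_prob_sum : (0 < #|I|)%N -> forall A, measurable A ->
  P ((fun w => \sum_i X i w) @^-1` A) = normal_prob (0:R) (Num.sqrt (\sum_i v i)) A.
Proof.
move=> I0 A mA; case E : (enum I) => [|i s].
  by move: I0; rewrite cardT E.
have sumE (f : I -> R) : \sum_k f k = \sum_(k <- i :: s) f k by rewrite -E big_enum.
have us : uniq (i :: s) by rewrite -E enum_uniq.
have noJ (Q : I -> Prop) j : j \in (finset.set0 : {set I}) -> Q j.
  by rewrite finset.in_set0.
have := normal_sum_disjoint us (noJ _) (noJ (fun j => F j setT)) mA.
rewrite (_ : \bigcap_(j in _) _ = setT); last by apply/seteqP; split => // w _ j /noJ.
rewrite setIT probability_setT mule1 sumE => <-.
rewrite (_ : (fun w => \sum_k X k w) = fun w => \sum_(k <- i :: s) X k w)//.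
by apply/funext => w; rewrite sumE.
Qed.

End mutual_independence.

End normal_sums.

(** * Normal laws with different variances *)

Section normal_comparison.
Context {R : realType}.

Lemma measurable_norm_gt (l : R) : measurable [set x : R | l < `|x|].
Proof.
rewrite -[X in measurable X]setTI (_ : [set x | _] = (@Num.norm _ R) @^-1` `]l, +oo[).
  by apply: (@normr_measurable _ setT).
by apply/seteqP; split => x /=; rewrite in_itv/= andbT.
Qed.

Lemma normal_peak_sqrtE (v w : R) : 0 < v -> 0 < w ->
  normal_peak (Num.sqrt v) = Num.sqrt (w / v) * normal_peak (Num.sqrt w).
Proof.
move=> v0 w0; rewrite /normal_peak !sqr_sqrtr ?ltW//.
rewrite -!sqrtrV ?mulrn_wge0 ?mulr_ge0 ?pi_ge0 ?ltW// -sqrtrM ?divr_ge0 ?ltW//.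
congr (Num.sqrt _).
move: (pi_gt0 R); move: (pi : R) => p p0.
by field; rewrite !gt_eqF.
Qed.

Lemma le_normal_prob (s t c : R) (A : set R) : 0 <= c -> measurable A ->
  (forall x, A x -> normal_pdf 0 s x <= c * normal_pdf 0 t x) ->
  (normal_prob 0%R s A <= c%:E * normal_prob 0%R t A)%E.
Proof.
move=> c0 mA le_pdf; rewrite /normal_prob.
have mpdf u : measurable_fun A (fun x : measurableTypeR R => (normal_pdf 0 u x)%:E).
  by apply/measurable_EFinP/measurable_funTS; exact: measurable_normal_pdf.
apply: (@le_trans _ _ (\int[lebesgue_measure]_(x in A) (c%:E * (normal_pdf 0 t x)%:E))%E).
  apply: ge0_le_integral => //.
  - by move=> x _; rewrite lee_fin normal_pdf_ge0.
  - exact: mpdf.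
  - by apply: emeasurable_funM => //; exact: mpdf.
rewrite ge0_integralZl//; first exact: mpdf.
by move=> x _; rewrite lee_fin normal_pdf_ge0.
Qed.

(** Widening a centred normal law decreases only the normalising constant of its
    density; the exponential factor increases everywhere. *)
Lemma normal_prob_le_variance (v w : R) (A : set R) : 0 < v -> v <= w ->
  measurable A ->
  (normal_prob 0%R (Num.sqrt v) A <=
   (Num.sqrt (w / v))%:E * normal_prob 0%R (Num.sqrt w) A)%E.
Proof.
move=> v0 vw mA; have w0 : 0 < w by exact: lt_le_trans vw.
apply: le_normal_prob => // x _.
rewrite !normal_pdfE ?gt_eqF ?sqrtr_gt0// (normal_peak_sqrtE v0 w0).
rewrite -mulrA ler_wpM2l ?sqrtr_ge0// ler_wpM2l ?normal_peak_ge0//.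
rewrite /normal_fun ler_expR !sqr_sqrtr ?(ltW v0) ?(ltW w0)// subr0 !mulNr lerN2.
by rewrite ler_wpM2l ?sqr_ge0// lef_pV2 ?posrE ?pmulrn_lgt0// lerMn2r.
Qed.

(** With y = x^2 / (4 v), the exponential factor of the density of variance v is
    exp(-y) times that of the density of variance 2 v, and
    exp(-y) <= 2 / y^2 = 32 v^2 / x^4.  So the law of variance v is dominated
    on the tail by a small multiple of a probability; the ratio sqrt 2 <= 2 of the
    normalising constants turns 32 into 64.  The decay in v^2 beats the number of
    dyadic intervals in the chaining argument, which a bound linear in v would
    not. *)
Lemma normal_prob_tail (v l : R) : 0 < v -> 0 < l ->
  (normal_prob 0%R (Num.sqrt v) [set x | (l < `|x|)%R] <=
   (64 * v ^+ 2 / l ^+ 4)%:E)%E.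
Proof.
move=> v0 l0; have v20 : 0 < 2 * v by rewrite mulr_gt0.
have mA := measurable_norm_gt l.
have c0 : 0 <= 64 * v ^+ 2 / l ^+ 4.
  by rewrite divr_ge0 ?exprn_ge0 ?mulr_ge0 ?exprn_ge0// ltW.
apply: (@le_trans _ _ ((64 * v ^+ 2 / l ^+ 4)%:E *
    normal_prob 0%R (Num.sqrt (2 * v)) [set x | (l < `|x|)%R])%E); last first.
  rewrite -[leRHS]mule1; apply: lee_wpmul2l; first by rewrite lee_fin.
  exact: probability_le1.
apply: le_normal_prob => // x /= lx.
rewrite !normal_pdfE ?gt_eqF ?sqrtr_gt0// (normal_peak_sqrtE v0 v20).
rewrite /normal_fun subr0 !sqr_sqrtr ?(ltW v0) ?(ltW v20)//.
set y := x ^+ 2 / (2 * v *+ 2).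
have l2x2 : l ^+ 2 <= x ^+ 2.
  by rewrite -(real_normK (num_real x)) lerXn2r ?nnegrE ?(ltW l0) ?(ltW lx).
have x20 : 0 < x ^+ 2 by apply: lt_le_trans l2x2; rewrite exprn_gt0.
have y0 : 0 < y by rewrite divr_gt0// pmulrn_lgt0.
have -> : - x ^+ 2 / (v *+ 2) = - y - y.
  by rewrite /y; field; rewrite gt_eqF.
have -> : - x ^+ 2 / (2 * v *+ 2) = - y by rewrite mulNr.
rewrite expRD.
have sq2 : Num.sqrt (2 * v / v) <= 2.
  rewrite mulfK ?gt_eqF// -[leRHS]ger0_norm// -sqrtr_sqr ler_wsqrtr//; lra.
have ey : expR (- y) <= 2 / y ^+ 2.
  rewrite expRN -[leRHS]invf_div lef_pV2 ?posrE ?expR_gt0 ?divr_gt0 ?exprn_gt0//.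
  by apply: le_trans (expR_ge1Dxn 1 (ltW y0)); rewrite lerDr.
have y2 : 2 / y ^+ 2 <= 32 * v ^+ 2 / l ^+ 4.
  have -> : 2 / y ^+ 2 = 32 * v ^+ 2 / (x ^+ 2) ^+ 2.
    have xn0 : x != 0 by rewrite -sqrf_eq0 gt_eqF.
    by rewrite /y; field; rewrite ?xn0 ?gt_eqF.
  rewrite ler_wpM2l ?mulr_ge0 ?exprn_ge0 ?(ltW v0)//.
  rewrite lef_pV2 ?posrE ?(exprn_gt0 _ l0) ?(exprn_gt0 _ x20)//.
  by rewrite (exprM l 2 2) ler_pXn2r ?nnegrE ?sqr_ge0.
rewrite mulrACA ler_wpM2r ?mulr_ge0 ?normal_peak_ge0 ?expR_ge0//.
apply: (@le_trans _ _ (2 * (32 * v ^+ 2 / l ^+ 4))); last by rewrite !mulrA; lra.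
by rewrite ler_pM ?sqrtr_ge0 ?expR_ge0// (le_trans ey).
Qed.

End normal_comparison.

(** * Domination of laws along an almost sure limit *)

Lemma measurable_preimage (disp : measure_display) (T : measurableType disp)
    (R : realType) (f : T -> R) (A : set R) :
  measurable_fun setT f -> measurable A -> measurable (f @^-1` A).
Proof. by move=> mf mA; rewrite -[X in measurable X]setTI; exact: mf. Qed.

Section limit_in_law.
Context (disp : measure_display) (T : measurableType disp) (R : realType).
Context (P : probability T R).

Lemma ae_le_probability (A B : set T) : measurable A -> measurable B ->
  {ae P, forall w, A w -> B w} -> (P A <= P B)%E.
Proof.
move=> mA mB [N [mN N0 subN]].
apply: (@le_trans _ _ (P (B `|` N))).
  apply: le_measure; rewrite ?inE//; first exact: measurableU.
  move=> w Aw; have [Bw|nBw] := pselect (B w); first by left.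
  by right; apply: subN => /= /(_ Aw).
have PBN : (P (B `|` N) <= P B + P N)%E := measureU2 P mB mN.
by rewrite (le_trans PBN)// (N0 : P N = 0%E) adde0.
Qed.

Lemma ae_eq_probability (A B : set T) : measurable A -> measurable B ->
  {ae P, forall w, A w <-> B w} -> P A = P B.
Proof.
move=> mA mB AB; apply/eqP; rewrite eq_le; apply/andP; split;
  apply: ae_le_probability => //; apply: filterS AB => w /= [AB BA]; tauto.
Qed.

Variables (Q : probability (measurableTypeR R) R) (X_ : nat -> T -> R) (X : T -> R)
  (c : nat -> R).
Hypotheses (mX_ : forall n, measurable_fun setT (X_ n)) (mX : measurable_fun setT X)
  (X_cvg : {ae P, forall w, X_ n w @[n --> \oo] --> X w})
  (le_law : forall n A, measurable A -> (P (X_ n @^-1` A) <= (c n)%:E * Q A)%E)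
  (c1 : c n @[n --> \oo] --> (1 : R)).

(** If X lies in the open set U then so do all the X_ k from some rank n on; for
    each n this event has probability at most c k * Q U for all k >= n, hence at
    most Q U. *)
Let le_law_open (U : set R) : open U -> measurable U -> (P (X @^-1` U) <= Q U)%E.
Proof.
move=> oU mU; pose L n := \bigcap_(k in [set k | (n <= k)%N]) (X_ k @^-1` U).
have mL n : measurable (L n).
  by apply: bigcap_measurableType => k _; exact: measurable_preimage.
have ndL : nondecreasing_seq L.
  move=> n m nm; apply/subsetPset => w Lw k /= mk; apply: Lw => /=.
  exact: leq_trans mk.
have mUL : measurable (\bigcup_n L n) by exact: bigcupT_measurable.
apply: (@le_trans _ _ (P (\bigcup_n L n))).
  apply: ae_le_probability => //; first exact: measurable_preimage.
  apply: filterS X_cvg => w Xw Uw.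
  have [n _ nU] : \forall n \near \oo, U (X_ n w) by apply: Xw; exact: open_nbhs_nbhs.
  by exists n => // k /= nk; exact: nU.
have LQ n : (P (L n) <= Q U)%E.
  have : ((c k)%:E * Q U @[k --> \oo] --> 1%:E * Q U)%E.
    apply: cvgeZr; first exact: fin_num_measure.
    by apply: cvg_EFin => //; exact: nearW.
  rewrite mul1e => cQ; apply: (cvge_to_ge cQ).
  near=> k; apply: le_trans (le_law k mU).
  apply: le_measure; rewrite ?inE//; first exact: measurable_preimage.
  by move=> w; apply => /=; near: k; exact: nbhs_infty_ge.
apply: (cvge_to_le (nondecreasing_cvg_mu (mu := P) mL mUL ndL)).
by near=> n; exact: LQ.
Unshelve. all: by end_near. Qed.

(** Both sides are probabilities, so that an inequality on each ray and on its
    complement is an equality.  The domination holds on open rays by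
    [le_law_open], and on closed rays because they are decreasing intersections
    of open ones. *)
Lemma probability_limit_eq (A : set R) : measurable A -> P (X @^-1` A) = Q A.
Proof.
have ray_le x : (P (X @^-1` `]-oo, x]%classic) <= Q `]-oo, x]%classic)%E.
  pose F n := [set` Interval -oo%O (BSide true (x + n.+1%:R^-1))].
  have mF n : measurable (F n : set (measurableTypeR R)) by exact: measurable_itv.
  have niF : nonincreasing_seq F.
    move=> m n mn; apply/subsetPset; apply: subset_itvl.
    by rewrite bnd_simp lerD2l lef_pV2 ?posrE// ler_nat.
  have mcapF : measurable (\bigcap_n F n) by exact: bigcapT_measurable.
  have FE : `]-oo, x]%classic = \bigcap_n F n by exact: itvNycEbigcap.
  have cvgP : P (X @^-1` F n) @[n --> \oo] --> P (X @^-1` `]-oo, x]%classic).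
    rewrite FE preimage_bigcap; apply: nonincreasing_cvg_mu.
    - by rewrite -ge0_fin_numE// fin_num_measure//; exact: measurable_preimage (mF 0%N).
    - by move=> n; exact: measurable_preimage (mF n).
    - by rewrite -preimage_bigcap; exact: measurable_preimage mcapF.
    - by move=> m n mn; apply/subsetPset; apply: preimage_subset; exact/subsetPset/niF.
  have cvgQ : Q (F n) @[n --> \oo] --> Q `]-oo, x]%classic.
    rewrite FE; apply: nonincreasing_cvg_mu => //.
    by rewrite -ge0_fin_numE// fin_num_measure.
  apply: (lee_cvg_to cvgP cvgQ); near=> n.
  by apply: le_law_open; [exact: interval_open|exact: mF].
have ray_eq x : P (X @^-1` `]x, +oo[%classic) = Q `]x, +oo[%classic.
  have le_ray : (P (X @^-1` `]x, +oo[%classic) <= Q `]x, +oo[%classic)%E.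
    by apply: le_law_open; [exact: interval_open|exact: measurable_itv].
  apply/eqP; rewrite eq_le le_ray/=.
  have EQ : Q `]x, +oo[%classic = (1 - Q `]-oo, x]%classic)%E.
    by rewrite -probability_setC// setCitvl.
  have EP : P (X @^-1` `]x, +oo[%classic) = (1 - P (X @^-1` `]-oo, x]%classic))%E.
    rewrite -probability_setC; last exact: measurable_preimage mX (measurable_itv _).
    by rewrite preimage_setC setCitvl.
  by rewrite EQ EP; apply: leeB.
move=> mA.
pose g n : set (measurableTypeR R) := `](- n%:R), +oo[%classic.
have GI : setI_closed (@RGenOInfty.G R).
  move=> _ _ [x ->] [y ->]; exists (Num.max x y).
  by apply/seteqP; split => z /=; rewrite !in_itv/= !andbT gt_max => /andP.
have Gg n : (@RGenOInfty.G R) (g n) by exists (- n%:R).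
have gT : \bigcup_k (g k) = setT.
  apply/seteqP; split => // x _; exists (Num.truncn `|x|).+1 => //=.
  rewrite /g/= in_itv/= andbT ltrNl (le_lt_trans (ler_norm _))// normrN.
  exact: truncnS_gt.
have uniq := @measure_unique _ R (measurableTypeR R) (@RGenOInfty.G R) g
  (RGenOInfty.measurableE R) GI Gg gT (pushforward P (X : T -> measurableTypeR R)) Q.
apply: (uniq mX) => // [_ [x ->]|k]; first exact: ray_eq.
rewrite -ge0_fin_numE// fin_num_measure//.
exact: measurable_preimage mX (measurable_itv _).
Unshelve. all: by end_near. Qed.

End limit_in_law.

(** * Dyadic chaining *)

Section chaining.
Context {R : realType}.
Implicit Types (f : R -> R) (c r : R).

(** A dyadic point of level n + 1 is either of level n, or the right end of an
    interval of level n + 1 whose left end is of level n; so one more increment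
    is paid at each level. *)
Lemma dyadic_chaining f c r : 0 <= c -> 0 <= r -> f 0 = 0 ->
  (forall n k, (k < 2 ^ n)%N ->
    `|f (k.+1%:R / 2 ^+ n) - f (k%:R / 2 ^+ n)| <= c * r ^+ n) ->
  forall n k, (k <= 2 ^ n)%N ->
    `|f (k%:R / 2 ^+ n)| <= c * \sum_(j < n.+1) r ^+ j.
Proof.
move=> c0 r0 f0 inc; elim=> [|n IH] k.
  rewrite big_ord1 expn0 !expr0; case: k => [|[|//]] _.
    by rewrite mul0r f0 normr0 mulr1.
  have := inc 0%N 0%N isT.
  by rewrite !expr0 mul0r f0 subr0.
move=> kn; have halfE : (k./2%:R / 2 ^+ n : R) = k./2.*2%:R / 2 ^+ n.+1.
  rewrite -mul2n natrM exprS -mulf_div divff ?mul1r//.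
have kn2 : (k./2 <= 2 ^ n)%N by move: kn; rewrite expnS; lia.
have := IH _ kn2; rewrite halfE => IHk; rewrite big_ord_recr/= mulrDr.
have [kodd|keven] := boolP (odd k); last first.
  have -> : k = k./2.*2 by rewrite -[LHS]odd_double_half (negbTE keven).
  by rewrite (le_trans IHk)// lerDl mulr_ge0 ?exprn_ge0.
have kE : k = k./2.*2.+1 by rewrite -[LHS]odd_double_half kodd.
have := inc n.+1 k./2.*2; rewrite -kE => /(_ kn) inck.
rewrite -[X in `|X|](subrK (f (k./2.*2%:R / 2 ^+ n.+1))) addrC.
by rewrite (le_trans (ler_normD _ _))// lerD.
Qed.

Lemma sum_geometric_le r n : 0 <= r -> r < 1 ->
  \sum_(j < n) r ^+ j <= (1 - r)^-1.
Proof.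
move=> r0 r1; have d0 : 0 < 1 - r by rewrite subr_gt0.
rewrite -(ler_pM2l d0) divff ?gt_eqF// -opprB mulNr -subrX1 opprB.
by rewrite gerBl exprn_ge0.
Qed.

Lemma chaining f c r : 0 <= c -> 0 <= r -> r < 1 -> f 0 = 0 ->
  {within `[0, +oo[, continuous f} ->
  (forall n k, (k < 2 ^ n)%N ->
    `|f (k.+1%:R / 2 ^+ n) - f (k%:R / 2 ^+ n)| <= c * r ^+ n) ->
  forall t, 0 <= t <= 1 -> `|f t| <= c / (1 - r).
Proof.
move=> c0 r0 r1 f0 fcont inc t /andP[t0 t1].
(* u n is the largest dyadic point of level n below t. *)
pose k n := Num.truncn (t * 2 ^+ n); pose u n : R := (k n)%:R / 2 ^+ n.
have p0 n : 0 < (2 ^+ n : R) by rewrite exprn_gt0.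
have kn n : (k n <= 2 ^ n)%N.
  rewrite -(ler_nat R) natrX; apply: (@le_trans _ _ (t * 2 ^+ n)).
    by rewrite truncn_le mulr_ge0 ?exprn_ge0.
  by rewrite ler_piMl// ltW.
have u0 n : 0 <= u n by rewrite divr_ge0// ltW.
have ut n : t - (2^-1) ^+ n <= u n <= t.
  rewrite /u ler_pdivrMr// ler_pdivlMr// mulrBl -exprMn mulVf// expr1n.
  rewrite truncn_le mulr_ge0 ?exprn_ge0// andbT lerBlDr natr1.
  exact/ltW/truncnS_gt.
have u_cvg : u n @[n --> \oo] --> t.
  apply: (@squeeze_cvgr _ _ _ _ (fun n => t - 2^-1 ^+ n) (cst t)); last exact: cvg_cst.
    by near=> n; exact: ut.
  rewrite -[X in _ --> X]subr0; apply: cvgB; first exact: cvg_cst.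
  by apply: cvg_expr; rewrite ger0_norm ?invf_lt1 ?ltr1n.
have fu_cvg : f (u n) @[n --> \oo] --> f t.
  have /subspace_continuousP/(_ t) := fcont.
  rewrite /= in_itv/= andbT => /(_ t0) ft.
  have u_within : u n @[n --> \oo] --> within `[0, +oo[ (nbhs t).
    move=> A /= tA; have [N _ NA] := u_cvg _ tA.
    by exists N => // n /= Nn; apply: (NA n Nn); rewrite /= in_itv/= andbT.
  exact: cvg_comp u_within ft.
apply: (cvgr_to_le (cvg_norm fu_cvg)); near=> n.
apply: le_trans (dyadic_chaining c0 r0 f0 inc (kn n)) _.
by rewrite ler_wpM2l// sum_geometric_le.
Unshelve. all: by end_near. Qed.

End chaining.

(** * Motion of the center of mass *)

Section dynamics.
Context (disp : measure_display) (T : measurableType disp) (R : realType) (n : nat).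

Definition mean_noise (B : nat -> nat -> R -> T -> 'rV[R]_n) (m : nat) (t : R) (w : T) :
    'rV[R]_n :=
  (2 ^+ m)^-1 *: \sum_(i < 2 ^ m) B m i t w.

Lemma Rintegral_sum (I : finType) (D : set (measurableTypeR R)) (f : I -> R -> R) :
  measurable D ->
  (forall i, lebesgue_measure.-integrable D (EFin \o f i)) ->
  \sum_i \int[lebesgue_measure]_(x in D) f i x =
  \int[lebesgue_measure]_(x in D) \sum_i f i x.
Proof.
move=> mD intf; rewrite /Rintegral sum_fine; last first.
  by move=> i _; exact: (integrable_fin_num mD (intf i)).
rewrite -(@integral_sum _ _ _ lebesgue_measure D mD _ (fun i x => (f i x)%:E)) //.
by congr fine; apply: eq_integral => x _; rewrite sumEFin.
Qed.

Lemma sum_offspring (V : nmodType) (f : nat -> V) (N : nat) :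
  \sum_(i < 2 * N) f i./2 = (\sum_(i < N) f i) *+ 2.
Proof.
elim: N => [|N IH]; first by rewrite muln0 !big_ord0 mul0rn.
rewrite mulnS !add2n !big_ord_recr/= IH mul2n doubleK uphalf_double.
by rewrite mulrnDl addrA mulr2n.
Qed.

Lemma sum_attraction (Z : R -> nat -> T -> 'rV[R]_n) (m : nat) (w : T) (s : R) :
  \sum_(i < 2 ^ m) attraction Z m i w s = 0.
Proof.
rewrite /attraction; under eq_bigr do rewrite sumrB.
by rewrite sumrB [X in X - _]exchange_big/= subrr.
Qed.

(** Everything here holds path by path.  For tau < 1 the equations of motion are
    averaged, and the attraction cancels by [sum_attraction].  The value at
    tau = 1 is the position after the branching at time m + 1; it is the left
    limit of the center of mass, since the offspring start from the left limit
    of their parent, each parent counting twice. *)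
Lemma center_of_mass_step (gamma : R) (B : nat -> nat -> R -> T -> 'rV[R]_n)
    (Z : R -> nat -> T -> 'rV[R]_n) (m : nat) (w : T) :
  (forall i, (i < 2 ^ m.+1)%N ->
     Z t i./2 w @[t --> (m.+1%:R : R)^'-] --> Z m.+1%:R i w) ->
  (forall i, (i < 2 ^ m)%N -> {within `[0, +oo[, continuous (fun t => B m i t w)}) ->
  (forall i (tau : R), (i < 2 ^ m)%N -> 0 <= tau < 1 ->
    (forall k, lebesgue_measure.-integrable `[0, tau]
       (EFin \o (fun s => attraction Z m i w s 0 k))) /\
    Z (m%:R + tau) i w =
      Z m%:R i w + B m i tau w +
      (gamma / 2 ^+ m) *:
        \row_k \int[lebesgue_measure]_(s in `[0, tau])
                 attraction Z m i w s 0 k) ->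
  forall tau, 0 <= tau <= 1 ->
  center_of_mass Z (m%:R + tau) w = center_of_mass Z m%:R w + mean_noise B m tau w.
Proof.
move=> branching Bcont motion.
have truncm (t : R) : 0 <= t < 1 -> Num.truncn (m%:R + t) = m.
  by move=> /andP[t0 t1]; apply: truncn_def; rewrite lerDl t0 -natr1 ltrD2l.
have step t : 0 <= t < 1 ->
    center_of_mass Z (m%:R + t) w = center_of_mass Z m%:R w + mean_noise B m t w.
  move=> t01; rewrite /center_of_mass /mean_noise /nb_particles truncm// natrK.
  rewrite -natrX -scalerDr -big_split/=; congr (_ *: _).
  under eq_bigr => i _ do rewrite (motion i t (ltn_ord i) t01).2.
  rewrite big_split/= -scaler_sumr [X in _ + _ *: X](_ : _ = 0) ?scaler0 ?addr0//.
  apply/rowP => k; rewrite summxE mxE.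
  under eq_bigr do rewrite mxE.
  rewrite Rintegral_sum//; last by move=> i; exact: (motion i t (ltn_ord i) t01).1.
  under eq_Rintegral do rewrite -summxE sum_attraction mxE.
  by rewrite Rintegral_cst// mul0r.
move=> tau /andP[tau0]; rewrite le_eqVlt => /predU1P[->|tau1]; last first.
  by apply: step; rewrite tau0.
rewrite natr1.
have left_near : \forall t \near (m.+1%:R : R)^'-, 0 <= t - m%:R < 1.
  near=> t; apply/andP; split.
    rewrite subr_ge0; near: t; apply: nbhs_left_ge.
    by rewrite ltr_nat.
  by rewrite ltrBlDl natr1; near: t; exact: nbhs_left_lt.
have com_left : center_of_mass Z t w @[t --> (m.+1%:R : R)^'-] -->
    center_of_mass Z m.+1%:R w.
  rewrite {2}/center_of_mass /nb_particles natrK.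
  have : (2 ^ m.+1)%:R^-1 *: \sum_(i < 2 ^ m.+1) Z t i./2 w @[t --> (m.+1%:R : R)^'-] -->
     (2 ^ m.+1)%:R^-1 *: \sum_(i < 2 ^ m.+1) Z m.+1%:R i w.
    apply: cvgZr; apply: cvg_big => [|i _]; last exact: branching.
    exact: add_continuous.
  apply: cvg_trans; apply: near_eq_cvg; near=> t.
  have t01 : 0 <= t - m%:R < 1 by near: t.
  rewrite /center_of_mass /nb_particles -[in RHS](subrKC m%:R t) truncm// subrKC.
  rewrite expnS natrM mulrC invfM -scalerA; congr (_ *: _).
  rewrite (sum_offspring (fun i => Z t i w)) -[X in _ *: X = _]scaler_nat.
  by rewrite scalerA mulVf ?scale1r// pnatr_eq0.
have noise_left : mean_noise B m (t - m%:R) w @[t --> (m.+1%:R : R)^'-] -->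
    mean_noise B m 1 w.
  apply: cvgZr; apply: cvg_big => [|i _]; first exact: add_continuous.
  have /subspace_continuousP/(_ 1) := Bcont i (ltn_ord i).
  rewrite /= in_itv/= andbT => /(_ ler01) B1.
  have sub1 : t - m%:R @[t --> (m.+1%:R : R)^'-] --> within `[0, +oo[ (nbhs (1 : R)).
    have c1 : t - m%:R @[t --> (m.+1%:R : R)^'-] --> (1 : R).
      rewrite [X in _ --> X](_ : 1 = m.+1%:R - m%:R); last first.
        by rewrite -natr1 addrAC subrr add0r.
      by apply: cvgB; [exact: cvg_at_left_filter cvg_id|exact: cvg_cst].
    move=> A /= A1; apply: filterS2 left_near (c1 _ A1) => t /andP[t0 _] At.
    by move: At => /=; apply; rewrite ?in_itv/= ?andbT.
  exact: cvg_comp sub1 B1.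
have noise_com_left : center_of_mass Z m%:R w + mean_noise B m (t - m%:R) w
    @[t --> (m.+1%:R : R)^'-] --> center_of_mass Z m%:R w + mean_noise B m 1 w.
  exact: cvgD (cvg_cst _) noise_left.
have com_left' : center_of_mass Z t w @[t --> (m.+1%:R : R)^'-] -->
    center_of_mass Z m%:R w + mean_noise B m 1 w.
  apply: cvg_trans noise_com_left; apply: near_eq_cvg; near=> t.
  have t01 : 0 <= t - m%:R < 1 by near: t.
  by rewrite -step// subrKC.
exact: norm_cvg_unique com_left com_left'.
Unshelve. all: by end_near. Qed.

End dynamics.

(** * Law of the driving noise *)

Definition dot (R : realType) (n : nat) (u x : 'rV[R]_n) : R := (u *m x^T) 0 0.

Section dot_theory.
Context {R : realType} {n : nat}.
Implicit Types (u x y : 'rV[R]_n).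

Lemma dotE u x : dot u x = \sum_k u 0 k * x 0 k.
Proof. by rewrite /dot mxE; apply: eq_bigr => k _; rewrite mxE. Qed.

Lemma dotDr u x y : dot u (x + y) = dot u x + dot u y.
Proof. by rewrite /dot linearD mulmxDr mxE. Qed.

Lemma dotBr u x y : dot u (x - y) = dot u x - dot u y.
Proof. by rewrite /dot linearB mulmxBr !mxE. Qed.

Lemma dotZr a u x : dot u (a *: x) = a * dot u x.
Proof. by rewrite /dot linearZ/= -scalemxAr mxE. Qed.

Lemma dotZl a u x : dot (a *: u) x = a * dot u x.
Proof. by rewrite /dot -scalemxAl mxE. Qed.

Lemma dot_sumr (I : Type) (s : seq I) (f : I -> 'rV[R]_n) u :
  dot u (\sum_(i <- s) f i) = \sum_(i <- s) dot u (f i).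
Proof.
rewrite /dot linear_sum mulmx_sumr summxE; exact: eq_bigr.
Qed.

Lemma dot_delta k x : dot (delta_mx 0 k) x = x 0 k.
Proof. by rewrite /dot -rowE !mxE. Qed.

Lemma dot_gt0 u : u != 0 -> 0 < dot u u.
Proof.
move=> u0; have sq_ge0 k : 0 <= u 0 k * u 0 k by rewrite -expr2 sqr_ge0.
rewrite lt0r dotE sumr_ge0 ?andbT => [|k _]; last exact: sq_ge0.
apply: contra_neq u0 => /eqP; rewrite psumr_eq0// => /allP uk0.
apply/rowP => k; rewrite mxE; apply/eqP.
by have := uk0 k; rewrite mem_index_enum mulf_eq0 orbb => /(_ isT).
Qed.

End dot_theory.

Section sigma_fields.
Context (disp : measure_display) (T : measurableType disp) (R : realType) (n : nat).
Context (I : Type) (D : set I) (X : I -> T -> 'rV[R]_n).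

Lemma sigma_field_measurable :
  (forall a, D a -> random_vector (X a)) -> sigma_field D X `<=` measurable.
Proof.
move=> mX; apply: smallest_sub; first exact: sigma_algebra_measurable.
move=> _ [a Da] [k _] [A mA <-]; exact: mX.
Qed.

(** The sample space equipped with the sigma-field generated by the X a, so that
    being measurable for this sigma-field becomes an instance of
    [measurable_fun]. *)
Definition sigma_field_type : measurableType _ :=
  g_sigma_algebraType (\bigcup_(a in D) \bigcup_(k in [set: 'I_n])
    preimage_set_system setT (fun w => X a w 0 k) measurable).

Lemma sigma_field_preimage (f : sigma_field_type -> R) (A : set R) :
  measurable_fun setT f -> measurable A -> sigma_field D X (f @^-1` A).
Proof. by move=> mf mA; have := mf measurableT A mA; rewrite setTI. Qed.

Lemma sigma_field_coord (a : I) (k : 'I_n) : D a ->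
  measurable_fun setT (fun w : sigma_field_type => X a w 0 k).
Proof.
move=> Da _ A mA; apply: sub_sigma_algebra.
by exists a => //; exists k => //; exists A.
Qed.

Lemma sigma_field_dot (a : I) (u : 'rV[R]_n) : D a ->
  measurable_fun setT (fun w : sigma_field_type => dot u (X a w)).
Proof.
move=> Da; rewrite (_ : (fun w => _) = fun w => \sum_k u 0 k * X a w 0 k).
  by apply: measurable_sum => k; apply: measurable_funM => //; exact: sigma_field_coord.
by apply/funext => w; rewrite dotE.
Qed.

End sigma_fields.

Lemma measurable_dot (disp : measure_display) (T : measurableType disp) (R : realType)
    (n : nat) (X : T -> 'rV[R]_n) (u : 'rV[R]_n) :
  random_vector X -> measurable_fun setT (fun w => dot u (X w)).
Proof.
move=> mX; under eq_fun do rewrite dotE.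
by apply: measurable_sum => k; apply: measurable_funM => //; exact: mX.
Qed.

Section noise.
Context (R : realType) (disp : measure_display) (T : measurableType disp).
Context (P : probability T R) (d : nat) (gamma : R).
Context (B : nat -> nat -> R -> T -> 'rV[R]_d) (Z : R -> nat -> T -> 'rV[R]_d).
Hypothesis ZB : dyadic_bbm P gamma B Z.

(** The weight 1/2^m is moved into the vector u, so that the scalar product is a
    plain sum of 2^m independent normal variables of variance
    (t - s) |u|^2 / 4^m each. *)
Lemma mean_noise_increment_law (m : nat) (s t : R) (u : 'rV[R]_d) (A : set R) :
  0 <= s -> s < t -> u != 0 -> measurable A ->
  P ((fun w => dot u (mean_noise B m t w - mean_noise B m s w)) @^-1` A) =
  normal_prob (0 : R) (Num.sqrt ((t - s) / 2 ^+ m * dot u u)) A.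
Proof.
move=> s0 st u0 mA; have uu0 := dot_gt0 u0.
have p0 : 0 < (2 ^+ m : R) by rewrite exprn_gt0.
pose u' := (2 ^+ m)^-1 *: u.
pose F (i : 'I_(2 ^ m)) := sigma_field [set t | 0 <= t] (B m i).
pose X (i : 'I_(2 ^ m)) w := dot u' (B m i t w - B m i s w).
pose v := (t - s) * dot u' u'.
have t0 : 0 <= t by apply: le_trans (ltW st).
have -> : (fun w => dot u (mean_noise B m t w - mean_noise B m s w)) =
    fun w => \sum_i X i w.
  apply/funext => w; rewrite /mean_noise -scalerBr -sumrB dotZr dot_sumr mulr_sumr.
  by apply: eq_bigr => i _; rewrite /X /u' dotZl.
have v0 : 0 < v.
  rewrite mulr_gt0 ?subr_gt0// dot_gt0// scaler_eq0 negb_or u0 andbT.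
  by rewrite gt_eqF// invr_gt0.
have -> : (t - s) / 2 ^+ m * dot u u = \sum_(i < 2 ^ m) v.
  rewrite sumr_const card_ord /v /u' dotZl dotZr -[RHS]mulr_natl natrX.
  by field; rewrite gt_eqF.
apply: (normal_prob_sum (F := F)) => //.
- move=> i; apply: sigma_field_measurable => a /= a0.
  exact: (brownian_random_vector (bbm_noise ZB (ltn_ord i))).
- exact: bbm_noise_indep ZB m.
- move=> i; apply: measurable_dot => k.
  have mB := brownian_random_vector (bbm_noise ZB (ltn_ord i)).
  under eq_fun do rewrite !mxE.
  by apply: measurable_funB; exact: mB.
- move=> i E mE; apply: sigma_field_preimage => //.
  rewrite /X (_ : (fun w => _) = fun w => dot u' (B m i t w) - dot u' (B m i s w)).
    by apply: measurable_funB; exact: sigma_field_dot.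
  by apply/funext => w; rewrite dotBr.
- move=> i E mE; have [_] := brownian_increment_law (bbm_noise ZB (ltn_ord i)) s0 st.
  move=> /(_ u' E mE); rewrite -!/(dot _ _).
  have -> : dot u' 0 = 0 by rewrite /dot trmx0 mulmx0 mxE.
  have -> : dot (u' *m (t - s)%:M) u' = v by rewrite mul_mx_scalar dotZl.
  by rewrite /normal_law gt_eqF.
- by rewrite card_ord expn_gt0.
Qed.

End noise.

(** * Law of the center of mass *)

Section path.
Context (R : realType) (disp : measure_display) (T : measurableType disp).
Context (P : probability T R) (d : nat) (gamma : R).
Context (B : nat -> nat -> R -> T -> 'rV[R]_d) (Z : R -> nat -> T -> 'rV[R]_d).
Hypothesis ZB : dyadic_bbm P gamma B Z.

Lemma ae_forall_noise (Q : nat -> nat -> T -> Prop) :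
  (forall m i, (i < 2 ^ m)%N -> {ae P, forall w, Q m i w}) ->
  {ae P, forall w, forall m i, (i < 2 ^ m)%N -> Q m i w}.
Proof.
move=> aeQ; apply/ae_foralln => m; apply/ae_foralln => i.
by case: (ltnP i (2 ^ m)) => im; [apply: filterS (aeQ _ _ im)|exact: aeW].
Qed.

Lemma ae_noise_continuous : {ae P, forall w, forall m i, (i < 2 ^ m)%N ->
  {within `[0, +oo[, continuous (fun t => B m i t w)}}.
Proof.
by apply: ae_forall_noise => m i im; exact: brownian_continuous (bbm_noise ZB im).
Qed.

Lemma ae_mean_noise_start : {ae P, forall w, forall m, mean_noise B m 0 w = 0}.
Proof.
have : {ae P, forall w, forall m i, (i < 2 ^ m)%N -> B m i 0 w = 0}.
  by apply: ae_forall_noise => m i im; exact: brownian_start (bbm_noise ZB im).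
apply: filterS => w B0 m; rewrite /mean_noise big1 ?scaler0// => i _; exact: B0.
Qed.

Lemma ae_center_of_mass_step : {ae P, forall w, forall m tau, 0 <= tau <= 1 ->
  center_of_mass Z (m%:R + tau) w = center_of_mass Z m%:R w + mean_noise B m tau w}.
Proof.
apply: filterS3 (bbm_branching ZB) (bbm_motion ZB) ae_noise_continuous.
move=> w branching motion Bcont m tau tau01.
exact: center_of_mass_step (branching m) (Bcont m) (motion m) tau tau01.
Qed.

Lemma measurable_mean_noise_increment (m : nat) (s t : R) : 0 <= s -> 0 <= t ->
  random_vector (fun w => mean_noise B m t w - mean_noise B m s w).
Proof.
move=> s0 t0 k.
have mW r : 0 <= r -> measurable_fun setT (fun w => mean_noise B m r w 0 k).
  move=> r0; rewrite (_ : (fun w => _) =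
      fun w => (2 ^+ m)^-1 * \sum_(i < 2 ^ m) B m i r w 0 k); last first.
    by apply/funext => w; rewrite /mean_noise mxE summxE.
  apply: measurable_funM => //; apply: measurable_sum => i.
  exact: (brownian_random_vector (bbm_noise ZB (ltn_ord i))).
rewrite (_ : (fun w => _) =
    fun w => mean_noise B m t w 0 k - mean_noise B m s w 0 k).
  by apply: measurable_funB; exact: mW.
by apply/funext => w; rewrite !mxE.
Qed.

Lemma measurable_center_of_mass (m : nat) : random_vector (center_of_mass Z m%:R).
Proof.
move=> k; rewrite (_ : (fun w => _) =
    fun w => (nb_particles (m%:R : R))%:R^-1 *
      \sum_(i < nb_particles (m%:R : R)) Z m%:R i w 0 k); last first.
  by apply/funext => w; rewrite /center_of_mass mxE summxE.
apply: measurable_funM => //; apply: measurable_sum => i.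
exact: (bbm_random_vector ZB).
Qed.

(** The center of mass at time m is a function of the particles at time m, and
    the noise of the next unit of time is independent of these. *)
Lemma noise_indep_center_of_mass (m : nat) (u : 'rV[R]_d) (A A' : set R) :
  measurable A -> measurable A' ->
  P ((fun w => dot u (center_of_mass Z m%:R w)) @^-1` A `&`
     (fun w => dot u (mean_noise B m 1 w - mean_noise B m 0 w)) @^-1` A') =
  (P ((fun w => dot u (center_of_mass Z m%:R w)) @^-1` A) *
   P ((fun w => dot u (mean_noise B m 1 w - mean_noise B m 0 w)) @^-1` A'))%E.
Proof.
move=> mA mA'; rewrite setIC muleC; apply: (bbm_noise_past ZB).
- apply: sigma_field_preimage => //.
  rewrite (_ : (fun w => _) = fun w => (2 ^+ m)^-1 *
    \sum_(i < 2 ^ m) (dot u (B m i 1 w) - dot u (B m i 0 w))).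
    apply: measurable_funM => //; apply: measurable_sum => i.
    by apply: measurable_funB; apply: (sigma_field_dot
      (X := fun a : nat * R => B m a.1 a.2) (a := (nat_of_ord i, _))); split => //=.
  apply/funext => w; rewrite /mean_noise -scalerBr -sumrB dotZr dot_sumr.
  by congr (_ * _); apply: eq_bigr => i _; rewrite dotBr.
- apply: sigma_field_preimage => //.
  rewrite (_ : (fun w => _) = fun w => (nb_particles (m%:R : R))%:R^-1 *
    \sum_(i < nb_particles (m%:R : R)) dot u (Z m%:R i w)).
    apply: measurable_funM => //; apply: measurable_sum => i.
    apply: (sigma_field_dot
      (X := fun a : R * nat => Z a.1 a.2) (a := (m%:R, nat_of_ord i))).
    by split => //=; rewrite lexx andbT.
  by apply/funext => w; rewrite /center_of_mass dotZr dot_sumr.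
Qed.

(** The partial sum 1 + 1/2 + ... + 1/2^(m-1). *)
Definition com_variance (m : nat) : R := 2 - 2 / 2 ^+ m.

Lemma com_varianceS m : com_variance m.+1 = com_variance m + 1 / 2 ^+ m.
Proof. by rewrite /com_variance exprS; field; rewrite gt_eqF// exprn_gt0. Qed.

Lemma com_variance_gt0 m : 0 < com_variance m.+1.
Proof.
elim: m => [|m IH]; rewrite com_varianceS; first by rewrite /com_variance expr0; lra.
by rewrite addr_gt0// divr_gt0// exprn_gt0.
Qed.

(** The induction starts at time 1, where the variance is positive: at time 0
    the position is the constant 0, which has no density. *)
Lemma center_of_mass_law (m : nat) (u : 'rV[R]_d) (A : set R) :
  u != 0 -> measurable A ->
  P ((fun w => dot u (center_of_mass Z m.+1%:R w)) @^-1` A) =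
  normal_prob (0 : R) (Num.sqrt (com_variance m.+1 * dot u u)) A.
Proof.
move=> u0; have uu0 := dot_gt0 u0.
have mC l := measurable_dot u (measurable_center_of_mass l).
have mW l := measurable_dot u (measurable_mean_noise_increment l (lexx 0) ler01).
have incr : {ae P, forall w l, center_of_mass Z l.+1%:R w =
    center_of_mass Z l%:R w + (mean_noise B l 1 w - mean_noise B l 0 w)}.
  apply: filterS2 ae_center_of_mass_step ae_mean_noise_start => w step W0 l.
  by rewrite W0 subr0 -step ?natr1// ler01 lexx.
elim: m A => [|m IH] A mA.
  transitivity (P ((fun w => dot u (mean_noise B 0 1 w - mean_noise B 0 0 w)) @^-1` A)).
    apply: ae_eq_probability; [exact: measurable_preimage|exact: measurable_preimage|].
    apply: filterS2 incr (bbm_start ZB) => w /(_ 0%N) /= -> Z0.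
    by rewrite {1}/center_of_mass /nb_particles truncn0 big_ord1 Z0 scaler0 add0r.
  have v1E : (1 - 0) / 2 ^+ 0 * dot u u = com_variance 1 * dot u u.
    by rewrite com_varianceS /com_variance expr0; field.
  by rewrite (mean_noise_increment_law ZB _ (lexx 0) ltr01 u0 mA) v1E.
transitivity (P ((fun w => dot u (center_of_mass Z m.+1%:R w) +
    dot u (mean_noise B m.+1 1 w - mean_noise B m.+1 0 w)) @^-1` A `&` setT)).
  rewrite setIT; apply: ae_eq_probability.
  - exact: measurable_preimage.
  - by apply: measurable_preimage => //; exact: measurable_funD.
  by apply: filterS incr => w incr /=; rewrite incr dotDr.
have va : 0 < com_variance m.+1 * dot u u by rewrite mulr_gt0// com_variance_gt0.
have vb : 0 < (1 - 0) / 2 ^+ m.+1 * dot u u.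
  by rewrite subr0 mulr_gt0// divr_gt0// exprn_gt0.
have vE : com_variance m.+1 * dot u u + (1 - 0) / 2 ^+ m.+1 * dot u u =
    com_variance m.+2 * dot u u.
  by rewrite subr0 -mulrDl -com_varianceS.
rewrite (normal_prob_add va vb (mC m.+1) (mW m.+1) measurableT _ mA).
  by rewrite vE probability_setT mule1.
move=> E E' mE mE'; rewrite setIT noise_indep_center_of_mass//.
rewrite (IH _ mE) (mean_noise_increment_law ZB _ (lexx 0) ltr01 u0 mE').
by rewrite probability_setT mule1.
Qed.

End path.

(** * Almost sure convergence and law of the limit *)

Lemma geometric_increments_cvg (R : realType) (x : R ^nat) (c r : R) (M : nat) :
  0 <= c -> 0 <= r -> r < 1 ->
  (forall m, (M <= m)%N -> `|x m.+1 - x m| <= c * r ^+ m) -> cvgn x.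
Proof.
move=> c0 r0 r1 xM.
suff /cvg_ex[l xl] : cvgn (fun n => x (n + M)%N).
  by apply/cvg_ex; exists l; rewrite -(cvg_shiftn M).
pose y := (fun n => x (n + M)%N).
have -> : (fun n => x (n + M)%N) = (fun n => y 0%N + series (telescope y) n).
  by apply/funext => n; rewrite -eq_sum_telescope.
apply: is_cvgD; first exact: is_cvg_cst.
apply: normed_cvg.
apply: (@series_le_cvg _ _ (geometric (c * r ^+ M) r)) => [n|n|n|].
- exact: normr_ge0.
- by rewrite /= !mulr_ge0 ?exprn_ge0.
- by rewrite /= -mulrA -exprD (addnC M n); exact: xM (leq_addl _ _).
- by apply: is_cvg_geometric_series; rewrite ger0_norm.
Qed.

(** The first Borel-Cantelli lemma, for geometrically decreasing probabilities. *)
Lemma ae_eventually_not (disp : measure_display) (T : measurableType disp) (R : realType)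
    (P : probability T R) (E : nat -> set T) (c q : R) :
  0 <= c -> 0 <= q -> q < 1 -> (forall n, measurable (E n)) ->
  (forall n, (P (E n) <= (c * q ^+ n)%:E)%E) ->
  {ae P, forall w, exists N, forall n, (N <= n)%N -> ~ E n w}.
Proof.
move=> c0 q0 q1 mE PE.
have sumE : (\sum_(n <oo) P (E n) < +oo)%E.
  apply: (@le_lt_trans _ _ (c * (1 - q)^-1)%:E); last exact: ltry.
  apply: lime_le; first by apply: is_cvg_nneseries.
  apply: nearW => n; apply: (@le_trans _ _ (\sum_(0 <= k < n) (c * q ^+ k)%:E)%E).
    by apply: lee_sum => k _.
  rewrite sumEFin lee_fin -mulr_sumr ler_wpM2l// big_mkord.
  exact: sum_geometric_le.
exists (lim_sup_set E); split.
- by apply: bigcapT_measurable => k; apply: bigcup_measurable.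
- exact: lim_sup_set_cvg0.
- move=> w /= nE k _; apply: contrapT => nEk; apply: nE; exists k => n kn En.
  by apply: nEk; exists n.
Qed.

Lemma cvg_com_variance (R : realType) : com_variance R m @[m --> \oo] --> (2 : R).
Proof.
have half_cvg : (2^-1 : R) ^+ m @[m --> \oo] --> (0 : R).
  by apply: cvg_expr; rewrite ger0_norm ?invf_lt1 ?ltr1n.
have : 2 - 2 * (2^-1 : R) ^+ m @[m --> \oo] --> (2 - 2 * 0 : R).
  exact: cvgB (cvg_cst _) (cvgM (cvg_cst _) half_cvg).
rewrite mulr0 subr0 (_ : (fun m => _) = com_variance R)//.
by apply/funext => m; rewrite /com_variance exprVn.
Qed.

Section limit.
Context (R : realType) (disp : measure_display) (T : measurableType disp).
Context (P : probability T R) (d : nat) (gamma : R).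
Context (B : nat -> nat -> R -> T -> 'rV[R]_d) (Z : R -> nat -> T -> 'rV[R]_d).
Hypothesis ZB : dyadic_bbm P gamma B Z.

(** The ratio r must satisfy r < 1, so that the increments are summable along
    the chaining, and r^4 > 1/2, so that the 2^n dyadic intervals of level n are
    outweighed by the tail bound: 2^-s / r^(4 s) must be the general term of a
    convergent series. *)
Let r : R := 9 / 10.

Definition noise_increment (k : 'I_d) (m n j : nat) (w : T) : R :=
  (mean_noise B m (j.+1%:R / 2 ^+ n) w - mean_noise B m (j%:R / 2 ^+ n) w) 0 k.

Lemma noise_increment_tail (k : 'I_d) (m n j : nat) (l : R) : 0 < l ->
  (P [set w | (l < `|noise_increment k m n j w|)%R] <=
   (64 * ((2 ^+ (m + n))^-1) ^+ 2 / l ^+ 4)%:E)%E.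
Proof.
move=> l0; have p0 e : 0 < (2 ^+ e : R) by rewrite exprn_gt0.
pose u : 'rV[R]_d := delta_mx 0 k.
have uu : dot u u = 1 by rewrite dot_delta mxE !eqxx.
have u0 : u != 0.
  by apply/eqP => u0; have := oner_neq0 R; rewrite -uu {1}u0 /dot mul0mx mxE eqxx.
have s0 : 0 <= j%:R / 2 ^+ n :> R by rewrite divr_ge0// ltW.
have st : j%:R / 2 ^+ n < j.+1%:R / 2 ^+ n :> R.
  by rewrite ltr_pM2r ?invr_gt0// ltr_nat.
have mA := measurable_norm_gt l.
have := mean_noise_increment_law ZB m s0 st u0 mA.
have -> : (j.+1%:R / 2 ^+ n - j%:R / 2 ^+ n) / 2 ^+ m * dot u u = (2 ^+ (m + n))^-1 :> R.
  by rewrite uu mulr1 -mulrBl -natr1 addrAC subrr add0r mul1r -invfM exprD mulrC.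
have -> : (fun w => dot u (mean_noise B m (j.+1%:R / 2 ^+ n) w -
    mean_noise B m (j%:R / 2 ^+ n) w)) = noise_increment k m n j.
  by apply/funext => w; rewrite dot_delta.
move=> lawE; apply: le_trans (normal_prob_tail _ l0); last by rewrite invr_gt0.
by rewrite -lawE.
Qed.

(** Grouping the increments of W_m at level n by s = m + n makes each of these
    events a finite union, and leaves a single series to sum. *)
Let bad (k : 'I_d) (s : nat) : set T :=
  \big[setU/set0]_(n < s.+1) \big[setU/set0]_(j < 2 ^ n)
    [set w | (r ^+ s < `|noise_increment k (s - n) n j w|)%R].

Let measurable_bad_term (k : 'I_d) (m n j : nat) (l : R) :
  measurable [set w | (l < `|noise_increment k m n j w|)%R].
Proof.
have p0 e : 0 < (2 ^+ e : R) by rewrite exprn_gt0.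
apply: (measurable_preimage _ (measurable_norm_gt l)).
by apply: (measurable_mean_noise_increment ZB); rewrite divr_ge0// ltW.
Qed.

Let measurable_bad k s : measurable (bad k s).
Proof. by apply: bigsetU_measurable => n _; apply: bigsetU_measurable. Qed.

(** There are 2^(s+1) - 1 increments, each of variance 2^-s; thus the bound is
    128 (1 / (2 r^4))^s, and 1 / (2 r^4) = 5000 / 6561 < 4 / 5. *)
Let bad_le k s : (P (bad k s) <= (128 * (4 / 5) ^+ s)%:E)%E.
Proof.
have r0 : 0 < r by rewrite /r; lra.
pose c : R := 64 * ((2 ^+ s)^-1) ^+ 2 / (r ^+ s) ^+ 4.
apply: (@le_trans _ _ (\sum_(n < s.+1) \sum_(j < 2 ^ n) c%:E)%E).
  pose E n j := [set w | (r ^+ s < `|noise_increment k (s - n) n j w|)%R].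
  have mE n j : measurable (E n j) by exact: measurable_bad_term.
  have mU n : measurable (\big[setU/set0]_(j < 2 ^ n) E n j).
    by apply: bigsetU_measurable => j _; exact: mE.
  apply: le_trans (@Boole_inequality _ _ _ P (fun n => \big[setU/set0]_(j < 2 ^ n) E n j)
    s.+1 (fun n _ => mU n)) _.
  apply: lee_sum => n _.
  apply: le_trans (@Boole_inequality _ _ _ P (E n) (2 ^ n) (fun j _ => mE n j)) _.
  apply: lee_sum => j _.
  have := noise_increment_tail k (s - n) n j (exprn_gt0 s r0).
  by rewrite subnK// -ltnS.
under eq_bigr do rewrite sumEFin sumr_const card_ord.
rewrite sumEFin lee_fin.
have -> : \sum_(n < s.+1) c *+ (2 ^ n) = c * (2 ^+ s.+1 - 1).
  rewrite subrX1 (_ : 2 - 1 = 1 :> R); last by lra.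
  by rewrite mul1r mulr_sumr; apply: eq_bigr => n _; rewrite -natrX mulr_natr.
have r4 : r ^+ 4 = 6561 / 10000 by rewrite /r; field.
have c0 : 0 <= c.
  have rs4 : 0 <= (r ^+ s) ^+ 4 by do 2 apply: exprn_ge0; exact: ltW.
  by apply: divr_ge0 rs4; apply: mulr_ge0 => //; exact: sqr_ge0.
apply: (@le_trans _ _ (c * 2 ^+ s.+1)); first by rewrite ler_wpM2l// gerBl.
have -> : c * 2 ^+ s.+1 = 128 * ((2 * r ^+ 4)^-1) ^+ s.
  have -> : ((2 * r ^+ 4)^-1) ^+ s = (2 ^+ s)^-1 * ((r ^+ 4) ^+ s)^-1.
    by rewrite exprVn exprMn invfM.
  rewrite /c (_ : (r ^+ s) ^+ 4 = (r ^+ 4) ^+ s); last by rewrite -!exprM mulnC.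
  have : 0 < (r ^+ 4) ^+ s by do 2 apply: exprn_gt0.
  have : 0 < (2 ^+ s : R) by exact: exprn_gt0.
  rewrite (exprS 2 s); move: (2 ^+ s) ((r ^+ 4) ^+ s) => p y p0 y0.
  by field; rewrite !gt_eqF.
rewrite ler_wpM2l// lerXn2r ?nnegrE ?invr_ge0 ?mulr_ge0 ?r4//; lra.
Qed.

Lemma ae_mean_noise_small (k : 'I_d) : {ae P, forall w, exists M, forall m, (M <= m)%N ->
  forall t, 0 <= t <= 1 -> `|mean_noise B m t w 0 k| <= 10 * r ^+ m}.
Proof.
have r0 : 0 <= r by rewrite /r; lra.
have r1 : r < 1 by rewrite /r; lra.
have q0 : 0 <= 4 / 5 :> R by lra.
have q1 : 4 / 5 < 1 :> R by lra.
have ev := @ae_eventually_not _ _ _ P (bad k) 128 (4 / 5) (ler0n R 128) q0 q1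
  (measurable_bad k) (bad_le k).
apply: filterS3 (ae_mean_noise_start ZB) (ae_noise_continuous ZB) ev.
move=> w W0 Bcont [M notbad].
exists M => m Mm t t01.
have fcont : {within `[0, +oo[, continuous (fun t => mean_noise B m t w 0 k)}.
  apply/subspace_continuousP => x x0.
  have noise_cvg : mean_noise B m t w @[t --> within `[0, +oo[ (nbhs x)] -->
      mean_noise B m x w.
    apply: cvgZr; apply: cvg_big => [|i _]; first exact: add_continuous.
    by have /subspace_continuousP := Bcont m i (ltn_ord i); apply.
  exact: cvg_comp noise_cvg (@coord_continuous _ _ _ 0 k _).
have inc n j : (j < 2 ^ n)%N ->
    `|mean_noise B m (j.+1%:R / 2 ^+ n) w 0 k - mean_noise B m (j%:R / 2 ^+ n) w 0 k|
    <= r ^+ m * r ^+ n.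
  move=> jn; rewrite leNgt -exprD; apply/negP => lt_inc.
  have ns : (n < (m + n).+1)%N by rewrite ltnS leq_addl.
  apply: (notbad (m + n)%N); first by rewrite (leq_trans Mm)// leq_addr.
  have := bigcup_mkord (m + n).+1 (fun n' => \big[setU/set0]_(j' < 2 ^ n')
    [set w | (r ^+ (m + n) < `|noise_increment k (m + n - n') n' j' w|)%R]).
  rewrite /bad => <-; exists n => //.
  have := bigcup_mkord (2 ^ n) (fun j' =>
    [set w | (r ^+ (m + n) < `|noise_increment k (m + n - n) n j' w|)%R]).
  move=> <-; exists j => //=.
  by rewrite addnK; move: lt_inc; rewrite /noise_increment !mxE.
have f0 : mean_noise B m 0 w 0 k = 0 by rewrite W0 mxE.
have := chaining (exprn_ge0 m r0) r0 r1 f0 fcont inc t01.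
rewrite (_ : r ^+ m / (1 - r) = 10 * r ^+ m)// mulrC; congr (_ * _).
by rewrite /r; field.
Qed.

(** The upper limit makes the candidate measurable on the whole sample space,
    including the null set where the center of mass does not converge. *)
Definition com_limit (w : T) : 'rV[R]_d :=
  \row_k fine (limn_esup (fun m => (center_of_mass Z m%:R w 0 k)%:E)).

Lemma measurable_com_limit : random_vector com_limit.
Proof.
move=> k; rewrite (_ : (fun w => _) =
    fun w => fine (limn_esup (fun m => (center_of_mass Z m%:R w 0 k)%:E))); last first.
  by apply/funext => w; rewrite mxE.
apply: measurableT_comp => //.
apply: (@measurable_fun_limn_esup _ _ _ _ (fun m w => (center_of_mass Z m%:R w 0 k)%:E)).
by move=> m; apply/measurable_EFinP; exact: (measurable_center_of_mass ZB).
Qed.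

(** The positions at integer times have increments of order r^m, hence converge;
    at any other time t the center of mass is within 10 r^m of its position at
    time m = [t]. *)
Lemma ae_cvg_com_coord (k : 'I_d) : {ae P, forall w,
  (center_of_mass Z n%:R w 0 k @[n --> \oo] --> com_limit w 0 k) /\
  (center_of_mass Z t w 0 k @[t --> +oo] --> com_limit w 0 k)}.
Proof.
have r0 : 0 <= r by rewrite /r; lra.
have r1 : r < 1 by rewrite /r; lra.
apply: filterS2 (ae_center_of_mass_step ZB) (ae_mean_noise_small k) => w step [M small].
pose x m := center_of_mass Z m%:R w 0 k.
have x_cvg : x @ \oo --> com_limit w 0 k.
  have /cvg_ex[l xl] : cvgn x.
    apply: (@geometric_increments_cvg _ x 10 r M) => // m Mm.
    rewrite /x -natr1 step ?ler01 ?lexx//.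
    rewrite mxE addrAC subrr add0r; apply: small => //.
    by rewrite ler01 lexx.
  have xlE : (x n)%:E @[n --> \oo] --> l%:E.
    by apply: cvg_EFin => //; exact: nearW.
  rewrite (_ : com_limit w 0 k = l)//.
  by rewrite mxE is_cvg_limn_esupE; [rewrite (cvg_lim _ xlE)|exact: cvgP xlE].
split=> //.
have truncn_cvg : Num.truncn t @[t --> (+oo : set_system R)] --> (\oo : set_system nat).
  move=> A [N _ NA].
  have : \forall t \near (+oo : set_system R), N%:R <= t by exact: nbhs_pinfty_ge.
  apply: filterS => t Nt; apply: NA => /=.
  by rewrite truncn_ge_nat// (le_trans (ler0n R N)).
have r_cvg : 10 * r ^+ m @[m --> \oo] --> (0 : R).
  rewrite -[X in _ --> X](mulr0 10); apply: cvgM; first exact: cvg_cst.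
  by apply: cvg_expr; rewrite ger0_norm.
have lo_cvg : x m - 10 * r ^+ m @[m --> \oo] --> com_limit w 0 k.
  by rewrite -[X in _ --> X]subr0; exact: cvgB.
have hi_cvg : x m + 10 * r ^+ m @[m --> \oo] --> com_limit w 0 k.
  by rewrite -[X in _ --> X]addr0; exact: cvgD.
apply: squeeze_cvgr;
  [|exact: cvg_comp truncn_cvg lo_cvg|exact: cvg_comp truncn_cvg hi_cvg].
have : \forall t \near (+oo : set_system R), M%:R <= t by exact: nbhs_pinfty_ge.
apply: filterS => t Mt; have t0 : 0 <= t by rewrite (le_trans (ler0n R M)).
have /andP[mt tm] := truncn_itv t0.
set m := Num.truncn t in mt tm *.
have Mm : (M <= m)%N by rewrite truncn_ge_nat.
have t01 : 0 <= t - m%:R <= 1.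
  by rewrite subr_ge0 mt lerBlDr addrC natr1 ltW.
have yk := small m Mm _ t01.
have -> : center_of_mass Z t w 0 k = x m + mean_noise B m (t - m%:R) w 0 k.
  by rewrite -[in LHS](subrKC m%:R t) step// mxE.
by move: yk; rewrite ler_norml => /andP[ly hy]; rewrite /= -/m !lerD2l ly hy.
Qed.

Lemma ae_cvg_com : {ae P, forall w, center_of_mass Z t w @[t --> +oo] --> com_limit w}.
Proof.
have : {ae P, forall w, forall k,
    center_of_mass Z t w 0 k @[t --> +oo] --> com_limit w 0 k}.
  by apply: filter_forall => k; apply: filterS (ae_cvg_com_coord k) => w [].
apply: filterS => w coord_cvg; apply/cvg_ballP => e e0.
have : \forall t \near +oo, forall k, ball (com_limit w 0 k) e (center_of_mass Z t w 0 k).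
  by apply: filter_forall => k; exact: cvg_ball.
by apply: filterS => t near_t; split=> // i k; rewrite (ord1 i); exact: near_t.
Qed.

(** The constants of [probability_limit_eq] are the ratios of standard deviations
    given by [normal_prob_le_variance]. *)
Lemma com_limit_normal : normal_vector P 0 2%:M com_limit.
Proof.
split=> [|u A mA]; first exact: measurable_com_limit.
rewrite -!/(dot _ _).
have -> : dot u 0 = 0 by rewrite /dot trmx0 mulmx0 mxE.
have -> : dot (u *m 2%:M) u = 2 * dot u u by rewrite mul_mx_scalar dotZl.
(* For u = 0 the law is the point mass at 0, the degenerate case of normal_law. *)
have [->|u0] := eqVneq u 0.
  have dot0 x : dot (0 : 'rV[R]_d) x = 0 by rewrite /dot mul0mx mxE.
  rewrite /normal_law dot0 mulr0 eqxx.
  under eq_set do rewrite -/(dot _ _) dot0.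
  rewrite diracE; case: (boolP (0 \in A)) => [/set_mem A0|/negP nA0].
    by rewrite (_ : [set _ | _] = setT) ?probability_setT//; apply/seteqP; split.
  rewrite (_ : [set _ | _] = set0) ?measure0//; apply/seteqP; split => // w A0.
  by apply: nA0; exact: mem_set.
have uu0 := dot_gt0 u0.
rewrite /normal_law gt_eqF ?mulr_gt0//.
have v0 n : 0 < com_variance R n.+1 * dot u u by rewrite mulr_gt0// com_variance_gt0.
have v2 n : com_variance R n.+1 * dot u u <= 2 * dot u u.
  by rewrite ler_wpM2r ?(ltW uu0)// /com_variance gerBl divr_ge0// exprn_ge0.
apply: (@probability_limit_eq _ _ _ P (normal_prob 0 (Num.sqrt (2 * dot u u)))
  (fun n w => dot u (center_of_mass Z n.+1%:R w)) (fun w => dot u (com_limit w))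
  (fun n => Num.sqrt (2 * dot u u / (com_variance R n.+1 * dot u u)))) => //.
- by move=> n; apply: measurable_dot; exact: (measurable_center_of_mass ZB).
- exact: measurable_dot measurable_com_limit.
- have : {ae P, forall w, forall k,
      center_of_mass Z n%:R w 0 k @[n --> \oo] --> com_limit w 0 k}.
    by apply: filter_forall => k; apply: filterS (ae_cvg_com_coord k) => w [].
  apply: filterS => w coord_cvg; rewrite dotE.
  under eq_cvg do rewrite dotE.
  apply: cvg_big => [|k _]; first exact: add_continuous.
  apply: cvgM; first exact: cvg_cst.
  by rewrite (cvg_shiftS (fun n => center_of_mass Z n%:R w 0 k)); exact: coord_cvg.
- move=> n E mE; rewrite (center_of_mass_law ZB _ u0 mE).
  exact: normal_prob_le_variance.
- rewrite -[X in _ --> X]sqrtr1.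
  apply: continuous_cvg; first exact: sqrt_continuous.
  rewrite [X in _ --> X](_ : 1 = 2 * dot u u / (2 * dot u u)); last first.
    by rewrite divff// gt_eqF// mulr_gt0.
  apply: cvgM; first exact: cvg_cst.
  apply: cvgV; first by rewrite gt_eqF// mulr_gt0.
  apply: cvgM; last exact: cvg_cst.
  by rewrite (cvg_shiftS (com_variance R)); exact: cvg_com_variance.
Qed.

End limit.

Unset Implicit Arguments.
Set Strict Implicit.
Set Printing Implicit Defensive.

Theorem lemma5 (R : realType) (disp : measure_display)
    (T : measurableType disp) (P : probability T R)
    (d : nat) (d_ge1 : (1 <= d)%N) (gamma : R) (gamma_neq0 : gamma != 0)
    (B : nat -> nat -> R -> T -> 'rV[R]_d)
    (Z : R -> nat -> T -> 'rV[R]_d)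
    (ZB : dyadic_bbm P gamma B Z) :
  exists N : T -> 'rV[R]_d,
    normal_vector P 0 (2%:M) N /\
    {ae P, forall w, center_of_mass Z t w @[t --> +oo] --> N w}.
Proof.
by exists (com_limit Z); split; [exact: com_limit_normal ZB|exact: ae_cvg_com ZB].
Qed.
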